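(* Let $n\ge 3$, $p=\lfloor\frac{n+1}{2}\rfloor$, and let $V_q$ be the $(1+np)\times(1+np)$ $q$-Varchenko matrix of the arrangement of the lines extending the edges of a regular $n$-gon in $\mathbb R^2$, with regions ordered $R_0,\dots,R_{np}$ as in the context. Then the Smith normal form of $V_q$ over $\mathbb Z[q]$ is $$\begin{pmatrix}1&0&0\\0&(1-q^2)I_n&0\\0&0&(1-q^2)^2I_{n(p-1)}\end{pmatrix},$$ and the corresponding left and right transition matrices are $SP$ and $(SP)^t$, i.e. $(SP)V_q(SP)^t$ equals this diagonal matrix, where, in block form with block sizes $1,n,n,\dots,n$ ($p$ blocks of size $n$), $$P=\begin{pmatrix}1&0&0&\cdots&0\\-q\mathbf 1&I_n&0&\cdots&0\\0&-qI_n&I_n&\cdots&0\\ \vdots&\vdots&\ddots&\ddots&\vdots\\0&\cdots&0&-qI_n&I_n\end{pmatrix},\qquad S=\begin{pmatrix}1&0&0&\cdots&0\\0&I_n&0&\cdots&0\\0&-qJ&I_n&\cdots&0\\ \vdots&\vdots&\ddots&\ddots&\vdots\\0&\cdots&0&-qJ&I_n\end{pmatrix},$$ with $\mathbf 1$ the $n\times1$ column of ones and $J=\begin{pmatrix}0&I_{n-1}\\1&0\end{pmatrix}$ the $n\times n$ cyclic permutation matrix.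
   Context: For a hyperplane arrangement, the regions are the connected components of the complement of the union of the hyperplanes; $sep(R,R')$ is the set of hyperplanes separating $R$ from $R'$. The $q$-Varchenko matrix $V_q$ is indexed by the regions, with $(R,R')$-entry $q^{\#sep(R,R')}$. Labelling: $h_1,\dots,h_n$ are the lines extending the edges of the $n$-gon, numbered consecutively counter-clockwise (indices mod $n$). $R_0$ is the interior of the $n$-gon. There are $1+np$ regions; for $1\le r\le p$, $1\le x\le n$, $R_{(r-1)n+x}$ is the region with $sep(R_0,R_{(r-1)n+x})=\{h_x,h_{x+1},\dots,h_{x+r-1}\}$ (indices mod $n$). A Smith normal form over $\mathbb Z[q]$ of an $m\times m$ matrix $M$ over $\mathbb Z[q]$ is a diagonal matrix $D=\mathrm{diag}(d_1,\dots,d_m)$ with $d_k\mid d_{k+1}$ in $\mathbb Z[q]$ for all $k$ and $D=AMB$ with $A,B\in GL_m(\mathbb Z[q])$; $A$ and $B$ are the left and right transition matrices. *)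

(* Defs.v *)
From HB Require Import structures.
From mathcomp Require Import all_boot all_order all_algebra.
From mathcomp Require Import all_classical all_reals all_analysis.

Set Implicit Arguments.
Unset Strict Implicit.
Unset Printing Implicit Defensive.

Import Order.TTheory GRing.Theory Num.Theory.
Import numFieldNormedType.Exports.

Local Open Scope classical_set_scope.
Local Open Scope ring_scope.

(* Vertices and lines are indexed by nat and are n-periodic: the line of index
   k passes through the vertices k and k+1 of the polygon.  Since the n lines
   are distinct, sets of lines are represented by sets of residues in 'I_n; the
   line h_n of the 1-based cyclic numbering has residue 0. *)
Section Arrangement.
Variable R : realType.
Local Notation plane := (R * R)%type.

Definition orient (a b x : plane) : R :=
  (b.1 - a.1) * (x.2 - a.2) - (b.2 - a.2) * (x.1 - a.1).

Definition line_through (a b : plane) : set plane :=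
  [set x | orient a b x = 0].

Definition separates (a b : plane) (A B : set plane) : Prop :=
  (A `<=` [set x | 0 < orient a b x] /\ B `<=` [set x | orient a b x < 0]) \/
  (A `<=` [set x | orient a b x < 0] /\ B `<=` [set x | 0 < orient a b x]).

Variables (n : nat) (c : plane) (rho theta : R).

(* Every regular n-gon has this form, for some center c, circumradius rho > 0
   and phase theta; the vertices are listed counter-clockwise. *)
Definition vertex (k : nat) : plane :=
  (c.1 + rho * cos (theta + 2 * pi * k%:R / n%:R),
   c.2 + rho * sin (theta + 2 * pi * k%:R / n%:R)).

Definition polygon : set plane :=
  [set x | exists w : 'I_n -> R,
     [/\ forall k, 0 <= w k, \sum_k w k = 1 & x = \sum_k w k *: vertex k]].

Definition edge_line (k : nat) : set plane :=
  line_through (vertex k) (vertex k.+1).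

Definition complement : set plane := ~` \bigcup_(k in `I_n) edge_line k.

Definition regions : set (set plane) :=
  [set A | exists2 x, complement x & A = connected_component complement x].

Definition sep (A B : set plane) : {set 'I_n} :=
  [set k : 'I_n | `[< separates (vertex k) (vertex k.+1) A B >]]%SET.

Definition region_labelling (p : nat) (Reg : nat -> set plane) : Prop :=
  [/\ set_bij `I_(1 + n * p) regions Reg,
      Reg 0%N = interior polygon
    & forall r x, (1 <= r <= p)%N -> (1 <= x <= n)%N ->
        sep (Reg 0%N) (Reg ((r - 1) * n + x)%N) =
        [set k : 'I_n | [exists s : 'I_r, (k == x + s %[mod n])%N]]%SET].

Definition varchenko (m : nat) (Reg : nat -> set plane) : 'M[{poly int}]_m :=
  \matrix_(i, j) 'X^#|sep (Reg i) (Reg j)|.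

End Arrangement.

(* D is a Smith normal form of M, with left and right transition matrices A and
   B.  Divisibility is spelled out because polydiv's %| on {poly int} is
   pseudo-divisibility, which is weaker than divisibility in Z[q]. *)
Definition smith_normal_form_with (K : comUnitRingType) (m : nat)
    (M D A B : 'M[K]_m) : Prop :=
  [/\ is_diag_mx D,
      forall i j : 'I_m, j = i.+1 :> nat -> exists e : K, D j j = e * D i i,
      A \in unitmx, B \in unitmx
    & D = A *m M *m B].

(* The indeterminate q is 'X.  The size 1 + \sum_(r < p) n, equal to 1 + n * p,
   records the decomposition into one block of size 1 and p blocks of size n;
   the block of index r : 'I_p below is the (r+1)-th block of size n. *)
Section Transition.
Variables n p : nat.

Definition cyclic_mx : 'M[{poly int}]_n :=
  \matrix_(i, j) ((j : nat) == (i.+1 %% n)%N)%:R.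

Definition P_mx : 'M[{poly int}]_(1 + \sum_(r < p) n) :=
  block_mx
    1%:M 0
    (\mxcol_(r < p)
       (if r == 0%N :> nat then const_mx (- 'X) else 0 : 'cV[{poly int}]_n))
    (\mxblock_(r < p, s < p)
       (if r == s then 1%:M
        else if r == s.+1 :> nat then - ('X *: 1%:M)
        else 0 : 'M[{poly int}]_n)).

Definition S_mx : 'M[{poly int}]_(1 + \sum_(r < p) n) :=
  block_mx
    1%:M 0
    0 (\mxblock_(r < p, s < p)
         (if r == s then 1%:M
          else if r == s.+1 :> nat then - ('X *: cyclic_mx)
          else 0 : 'M[{poly int}]_n)).

Definition snf_mx : 'M[{poly int}]_(1 + \sum_(r < p) n) :=
  block_mx
    1%:M 0
    0 (\mxdiag_(r < p)
         (((1 - 'X^2) ^+ (if r == 0%N :> nat then 1 else 2))%:M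
            : 'M[{poly int}]_n)).

End Transition.

(* Main.v *)
Require Import Defs.
From HB Require Import structures.
From mathcomp Require Import all_boot all_order all_algebra.
From mathcomp Require Import all_classical all_reals all_analysis.
From mathcomp Require Import zify ring lra.

Set Implicit Arguments.
Unset Strict Implicit.
Unset Printing Implicit Defensive.

Import Order.TTheory GRing.Theory Num.Theory.
Import numFieldNormedType.Exports.

Local Open Scope ring_scope.

(** Write [A_R] for the set of lines separating a region [R] from [R_0].  The
    exponent of an entry of the Varchenko matrix is the size of the symmetric
    difference of two such sets, so the entry is a product over the lines of
    factors [1] (same side) or [q] (opposite sides).  The row of [S *m P] of an
    arc with first line [a] and last line [b] expands the product, over the
    lines, of [delta_in - q delta_out] at [a] and at [b], [delta_in] at the other
    lines of the arc and [delta_out] elsewhere.  At a single line,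
    [delta_in - q delta_out] is orthogonal to [delta_out] and has square
    [1 - q^2].  Hence the product of two rows vanishes as soon as an end of one
    arc lies outside the other arc, and two distinct arcs of at most
    [(n + 1) / 2] lines always have such an end.

    Geometrically, the regions are the nonempty sign classes of the lines, which
    are convex.  In polar coordinates around the center, a point of radius [r]
    and angle [phi] is beyond the line of direction [d] exactly when
    [cos (d - phi)] exceeds [apothem / r > 0], and the directions at angular
    distance less than [acos (apothem / r) < pi / 2] from [phi] form a cyclic
    interval. *)

(** * Cyclic arcs *)

Section Arcs.

(** Written exactly as the set in [region_labelling], so that the two agree by conversion. *)
Definition circ_arc (n r x : nat) : {set 'I_n} :=
  [set k : 'I_n | [exists s : 'I_r, (k == x + s %[mod n])%N]]%SET.

Variable m : nat.
Local Notation n := m.+1.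
Implicit Types (k X : 'I_n) (r x : nat).

Lemma eq_inZp k x : (k == inZp x) = (k == x %[mod n])%N.
Proof. by rewrite -val_eqE /= [in RHS]modn_small. Qed.

Lemma inZpD x y : inZp (x + y) = inZp x + inZp y :> 'I_n.
Proof. by apply: val_inj; rewrite /= modnDm. Qed.

Lemma arcP r x k : reflect (exists2 s, (s < r)%N & k = inZp (x + s)) (k \in circ_arc n r x).
Proof.
rewrite inE; apply: (iffP existsP) => [[s /[!(=^~ eq_inZp)] /eqP ->]|[s sr ->]].
  by exists s.
by exists (Ordinal sr); rewrite -eq_inZp.
Qed.

Lemma arc0 x : circ_arc n 0 x = finset.set0.
Proof. by apply/finset.setP => k; rewrite [RHS]inE; apply/arcP => -[]. Qed.

Lemma arcSl r x : circ_arc n r.+1 x = inZp x |: circ_arc n r x.+1.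
Proof.
apply/finset.setP => k; rewrite [RHS]in_setU1.
apply/arcP/orP => [[[|s] sr ->]|[/eqP ->|/arcP[s sr ->]]].
- by left; rewrite addn0.
- by right; apply/arcP; exists s; rewrite ?addSnnS.
- by exists 0%N; rewrite ?addn0.
- by exists s.+1; rewrite ?addSnnS.
Qed.

Lemma arcSr r x : circ_arc n r.+1 x = inZp (x + r) |: circ_arc n r x.
Proof.
apply/finset.setP => k; rewrite [RHS]in_setU1.
apply/arcP/orP => [[s]|[/eqP ->|/arcP[s sr ->]]].
- rewrite ltnS leq_eqVlt => /orP[/eqP -> ->|sr ->]; first by left.
  by right; apply/arcP; exists s.
- by exists r.
- by exists s; rewrite ?ltnS ?(ltnW sr).
Qed.

(** Membership becomes a bound on the offset from [x] in Z/n, on which arithmetic can be done. *)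
Lemma mem_arc r x k :
  (r <= n)%N -> (k \in circ_arc n r x) = ((k - inZp x : 'I_n)%R < r)%N.
Proof.
move=> rn; apply/arcP/idP => [[s sr ->]|kr].
  by rewrite inZpD addrC addKr /= modn_small // (leq_trans sr).
exists (k - inZp x : 'I_n) => //.
by rewrite inZpD valZpK addrC subrK.
Qed.

Lemma arc_mod r x : circ_arc n r (x %% n) = circ_arc n r x.
Proof.
by apply/finset.setP => k; rewrite !inE; apply: eq_existsb => s; rewrite modnDml.
Qed.

(* If both arcs contained each other's starting point without being equally
   placed, they would together wrap around the whole circle. *)
Lemma arc_start_cross r r' x x' :
    (r + r' <= n.+1)%N -> (r <= n)%N -> (r' <= n)%N ->
    inZp x \in circ_arc n r' x' -> inZp x' \in circ_arc n r x ->
  inZp x = inZp x' :> 'I_n.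
Proof.
move=> rr rn r'n; rewrite !mem_arc //.
move: (inZp x) (inZp x') => X X'; case: (eqVneq X X') => // XX'.
rewrite -[X' - X]opprB; have : X - X' != 0 by rewrite subr_eq0.
move: (X - X') => D; rewrite -val_eqE /= => D0.
by rewrite modn_small ?ltn_subrL ?lt0n ?D0 //=; have := ltn_ord D; lia.
Qed.

(** The starts coincide by [arc_start_cross]. Seen from the common start, the last lines have
    offsets [r] and [r'], and each offset is bounded by the other. *)
Lemma arc_cross r r' x x' :
    (r + r' < n)%N ->
    inZp x \in circ_arc n r'.+1 x' -> inZp (x + r) \in circ_arc n r'.+1 x' ->
    inZp x' \in circ_arc n r.+1 x -> inZp (x' + r') \in circ_arc n r.+1 x ->
  r = r' /\ inZp x = inZp x' :> 'I_n.
Proof.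
move=> rr xl xr xl' xr'.
have XX : inZp x = inZp x' :> 'I_n.
  by apply: arc_start_cross xl xl'; lia.
split=> //; apply/eqP; rewrite eqn_leq.
move: xr xr'; rewrite !mem_arc; [|lia|lia].
rewrite !inZpD XX addrC addKr addrC addKr /= !modn_small; [|lia|lia].
by rewrite !ltnS => -> ->.
Qed.

End Arcs.

(** * Products over the lines *)

Section Bracket.
Variables (T : finType) (K : comPzRingType) (q : K).
Implicit Types (E M A B : {set T}) (f : T -> bool -> K).

(** [f k b] is the weight of line [k] when it is counted in ([b] true) or out. For [M] disjoint from
    [E], expanding the product gives a sum over the subsets S of [E]: the plain product for the
    union of S and [M], times [- q] for each element of [E] outside S. *)
Definition bracket_factor E M f (k : T) : K :=
  if k \in E then f k true - q * f k false else f k (k \in M).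

Definition bracket E M f : K := \prod_k bracket_factor E M f k.

(** Linearity in the factor at [a]; iterated, it expands a bracket into plain products, those with
    empty [E]. *)
Lemma bracketU1 (a : T) E M f : a \notin E -> a \notin M ->
  bracket (a |: E) M f = bracket E (a |: M) f - q * bracket E M f.
Proof.
move=> aE aM; have split_a E' M' : bracket E' M' f =
    bracket_factor E' M' f a * \prod_(k | k != a) bracket_factor E' M' f k.
  by rewrite /bracket (bigD1 a).
rewrite !split_a {1 3 5}/bracket_factor !in_setU1 eqxx (negPf aE) (negPf aM) /=.
have -> : \prod_(k | k != a) bracket_factor (a |: E) M f k =
          \prod_(k | k != a) bracket_factor E M f k.
  by apply: eq_bigr => k /negPf ka; rewrite /bracket_factor in_setU1 ka.
have -> : \prod_(k | k != a) bracket_factor E (a |: M) f k =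
          \prod_(k | k != a) bracket_factor E M f k.
  by apply: eq_bigr => k /negPf ka; rewrite /bracket_factor in_setU1 ka.
by rewrite mulrBl mulrA.
Qed.

Definition overlap (b c : bool) : K := if b == c then 1 else q.

Lemma prod_overlap A B :
  \prod_k overlap (k \in A) (k \in B) = q ^+ #|(A :\: B) :|: (B :\: A)|.
Proof.
rewrite -prodr_const [RHS]big_mkcond /=; apply: eq_bigr => k _.
by rewrite !inE /overlap; case: (k \in A); case: (k \in B).
Qed.

(** The bilinear form given by [overlap], evaluated on two products of local vectors. It is
    multiplicative over the lines, hence a single bracket whose weight at [k] is a pairing with the
    other local vector. *)
Definition gram E M E' M' : K :=
  bracket E M (fun k b => bracket_factor E' M' (fun _ c => overlap c b) k).

(** The factor at [k] alone vanishes, being [q - q * 1]. *)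
Lemma gram_eq0 E M E' M' (k : T) :
  k \in E -> k \notin E' -> k \notin M' -> gram E M E' M' = 0.
Proof.
move=> kE kE' kM'; rewrite /gram /bracket (bigD1 k) //=.
by rewrite /bracket_factor kE (negPf kE') (negPf kM') /overlap /= mulr1 subrr mul0r.
Qed.

Lemma gram_eq0r E M E' M' (k : T) :
  k \in E' -> k \notin E -> k \notin M -> gram E M E' M' = 0.
Proof.
move=> kE kE' kM'; rewrite /gram /bracket (bigD1 k) //=.
by rewrite /bracket_factor kE (negPf kE') (negPf kM') /overlap /= mulr1 subrr mul0r.
Qed.

(** On [E] the factor is [(1 - q * q) - q * (q - q)]; elsewhere a line is compared with itself and
    contributes 1. *)
Lemma gram_diag E M : gram E M E M = (1 - q ^+ 2) ^+ #|E|.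
Proof.
rewrite -prodr_const [RHS]big_mkcond; apply: eq_bigr => k _.
rewrite /bracket_factor /overlap; case: (k \in E) => /=; last by rewrite eqxx.
by rewrite mulr1 subrr mulr0 subr0 expr2.
Qed.

End Bracket.

(** * The transition matrices *)

Section BlockAction.
Variables n p : nat.
Implicit Types v : nat -> 'cV[{poly int}]_n.

(** Shared by [P_mx] and [S_mx], whose lower right parts differ only in the subdiagonal block
    [B]. *)
Lemma bidiag_sum (r : 'I_p) (B : 'M[{poly int}]_n) v :
  \sum_(s < p) (if r == s then 1%:M else if r == s.+1 :> nat then B else 0) *m v s
  = v r + (if r : nat is r'.+1 then B *m v r' else 0).
Proof.
rewrite (bigD1 r) //= eqxx mul1mx; congr (_ + _).
case: r => [[|r] rp] /=.
  by rewrite big1 // => s; rewrite eq_sym => /negPf ->; rewrite mul0mx.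
have r'p : (r < p)%N by apply: ltnW.
rewrite (bigD1 (Ordinal r'p)) /=; last by rewrite -val_eqE /= ltn_eqF.
rewrite -val_eqE /= gtn_eqF // eqxx big1 ?addr0 // => s /andP[].
rewrite eq_sym => /negPf -> /eqP sr; case: eqP => [[rs]|_].
  by case: sr; apply: val_inj.
by rewrite mul0mx.
Qed.

(** When [v r] lists values on the arcs of [r.+1] lines, this subtracts ['X] times the value on the
    arc without its last line. One-line arcs fall back on [R_0], whose value is [a]. *)
Lemma P_mx_action (a : {poly int}) v :
  P_mx n p *m col_mx a%:M (\mxcol_(r < p) v r) =
  col_mx a%:M
    (\mxcol_(r < p) (v r - 'X *: (if r : nat is r'.+1 then v r' else const_mx a))).
Proof.
rewrite /P_mx mul_block_col mul1mx mul0mx addr0; congr col_mx.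
rewrite mxcol_mul mul_mxblock_mxrow -mxcolD; apply: eq_mxcol => r.
rewrite bidiag_sum addrC -addrA; congr (_ + _); case: r => [[|r] rp] /=.
  rewrite add0r mul_mx_scalar; apply/matrixP => i j.
  by rewrite !mxE mulrN mulrC.
by rewrite mul0mx addr0 mulNmx -scalemxAl mul1mx.
Qed.

(** The cyclic shift moves the start one line on, so the arc without its first line is subtracted.
    One-line arcs have a single end, already treated by [P_mx]. *)
Lemma S_mx_action (a : 'M[{poly int}]_1) v :
  S_mx n p *m col_mx a (\mxcol_(r < p) v r) =
  col_mx a
    (\mxcol_(r < p)
       (v r - 'X *: (if r : nat is r'.+1 then cyclic_mx n *m v r' else 0))).
Proof.
rewrite /S_mx mul_block_col mul1mx !mul0mx addr0 add0r; congr col_mx.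
rewrite mul_mxblock_mxrow; apply: eq_mxcol => r.
rewrite bidiag_sum; congr (_ + _); case: r => [[|r] rp] /=.
  by rewrite scaler0 oppr0.
by rewrite mulNmx -scalemxAl.
Qed.

Lemma det_bidiag (B : 'M[{poly int}]_n) :
  \det (\mxblock_(r < p, s < p)
    (if r == s then 1%:M else if r == s.+1 :> nat then B else 0)) = 1.
Proof.
rewrite det_trig.
  by apply: big1 => i _; rewrite mxE eqxx mxE eqxx.
apply/is_trig_mxblockP; split=> [r s rs|r]; last first.
  by rewrite eqxx; apply: scalar_mx_is_trig.
by rewrite -val_eqE !ltn_eqF // ltnW.
Qed.

Lemma SP_mx_unit : S_mx n p *m P_mx n p \in unitmx.
Proof.
have detP : \det (P_mx n p) = 1.
  apply: etrans (det_lblock _ _ _) _.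
  by rewrite (det_bidiag (- ('X *: 1%:M))) mulr1; apply: det1.
have detS : \det (S_mx n p) = 1.
  apply: etrans (det_lblock _ _ _) _.
  by rewrite (det_bidiag (- ('X *: cyclic_mx n))) mulr1; apply: det1.
rewrite unitmx_mul; apply/andP.
split; first by rewrite unitmxE detS unitr1.
by rewrite unitmxE detP unitr1.
Qed.

End BlockAction.

(** * Expansion of the row of an arc at its two ends *)

Section Rows.
Variable m : nat.
Local Notation n := m.+1.
Implicit Types (r x : nat) (i j : 'I_n).

(** Here and in [inner_arc] the arc has [r.+1] lines, in accordance with blocks numbered from 0. For
    [r = 0] the two ends coincide and the inner arc is empty. *)
Definition endpoints r x : {set 'I_n} := [set inZp x; inZp (x + r)]%SET.
Definition inner_arc r x : {set 'I_n} := circ_arc n r.-1 x.+1.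

Lemma arc_endpoints r x : circ_arc n r.+1 x = endpoints r x :|: inner_arc r x.
Proof.
rewrite /endpoints /inner_arc; case: r => [|r] /=.
  by rewrite arcSl !arc0 addn0 finset.setUid.
by rewrite arcSl arcSr finset.setUA addSnnS.
Qed.

Lemma inZp_shift_eq r x : (r < n)%N ->
  (inZp x == inZp (x + r) :> 'I_n) = (r == 0%N).
Proof.
move=> rn; rewrite inZpD eq_sym -subr_eq0 addrC addKr -val_eqE /=.
by rewrite modn_small.
Qed.

Lemma inZp_notin_arc r x : (r < n)%N -> (inZp x : 'I_n) \notin circ_arc n r x.+1.
Proof.
move=> rn; rewrite (mem_arc _ _ (ltnW rn)) -[x.+1]addn1 inZpD opprD addrA subrr add0r /=.
have [m0|m_gt0] := posnP m.
  by move: rn; rewrite {1}m0; case: r.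
by rewrite (modn_small (_ : 1 < n)%N) // subSS subn0 modn_small // -leqNgt.
Qed.

Lemma card_endpoints r x : (r < n)%N -> #|endpoints r x| = (r != 0%N).+1.
Proof. by move=> rn; rewrite cards2 inZp_shift_eq. Qed.

(** Expanding at both ends gives the whole arc, the arc without its last line, without its first,
    and without both: the pattern of [P_mx] followed by [S_mx]. *)
Lemma bracket_row r x (K : comPzRingType) (q : K) (f : 'I_n -> bool -> K) :
    (r < n)%N ->
  let g A := bracket q finset.set0 A f in
  bracket q (endpoints r x) (inner_arc r x) f =
  g (circ_arc n r.+1 x) - q * g (circ_arc n r x)
  - q * (if r is r'.+1 then g (circ_arc n r x.+1) - q * g (circ_arc n r' x.+1) else 0).
Proof.
move=> rn g; rewrite /endpoints /inner_arc /g; case: r rn => [|r] rn /=.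
  rewrite addn0 finset.setUid !arc0 -[[set _]%SET]finset.setU0 mulr0 subr0.
  by rewrite bracketU1 ?finset.in_set0 // arcSl arc0.
have -> : [set inZp x; inZp (x + r.+1)]%SET =
          inZp x |: (inZp (x + r.+1) |: finset.set0) :> {set 'I_n}.
  by rewrite finset.setU0.
have xr_notin : (inZp (x + r.+1) : 'I_n) \notin circ_arc n r x.+1.
  rewrite -addSnnS (mem_arc _ _ (ltnW (ltnW rn))) inZpD addrC addKr /=.
  by rewrite modn_small ?ltnn // ltnW.
have x_notin := inZp_notin_arc x (ltnW rn).
have x_xr : (inZp x : 'I_n) \notin inZp (x + r.+1) |: finset.set0.
  by rewrite finset.in_setU1 finset.in_set0 orbF inZp_shift_eq.
have xr_notin' : (inZp (x + r.+1) : 'I_n) \notin inZp x |: circ_arc n r x.+1.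
  by rewrite finset.in_setU1 negb_or eq_sym inZp_shift_eq.
rewrite bracketU1 // !bracketU1 ?finset.in_set0 //.
by rewrite [circ_arc n r.+2 x]arcSr [circ_arc n r.+1 x]arcSl
     [circ_arc n r.+1 x.+1]arcSr addSnnS.
Qed.

End Rows.

(** * Orthogonality of the rows and the diagonal form *)

Section Gram.
Variables m p : nat.
Local Notation n := m.+1.
Local Notation N := (1 + \sum_(r < p) n)%N.
Implicit Types (i j : 'I_N).

(** Row 0 stands for [R_0]. A row [inr k] lies in block [tagnat.sig1 k], and its arc starts at
    [(tagnat.sig2 k).+1] because starting lines are numbered from 1. *)
Definition row_endpoints i : {set 'I_n} :=
  if fintype.split i is inr k then endpoints m (tagnat.sig1 k) (tagnat.sig2 k).+1
  else finset.set0.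

Definition row_inner i : {set 'I_n} :=
  if fintype.split i is inr k then inner_arc m (tagnat.sig1 k) (tagnat.sig2 k).+1
  else finset.set0.

Definition row_set i : {set 'I_n} :=
  if fintype.split i is inr k then circ_arc n (tagnat.sig1 k).+1 (tagnat.sig2 k).+1
  else finset.set0.

(** Periodicity of [h] absorbs the wrap-around in the last row. *)
Lemma mul_cyclic_mx (h : nat -> {poly int}) :
  (forall x, h (x %% n)%N = h x) ->
  cyclic_mx n *m \col_(x < n) h x = \col_(x < n) h x.+1.
Proof.
move=> hmod; apply/matrixP => x y; rewrite !mxE.
have xn : (x.+1 %% n < n)%N by apply: ltn_pmod.
rewrite (bigD1 (Ordinal xn)) //= big1 => [|z]; last first.
  by rewrite -val_eqE !mxE /= => /negPf ->; rewrite mul0r.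
by rewrite !mxE /= eqxx mul1r addr0 hmod.
Qed.

Lemma circ_arc_modS r x : circ_arc n r (x %% n).+1 = circ_arc n r x.+1.
Proof. by rewrite -arc_mod -[(x %% n).+1]addn1 modnDml addn1 arc_mod. Qed.

(** The matrices carry out the expansion of [bracket_row]. The weight [f] stays free because
    [SP_gram] uses two choices of it, one for each side of the Varchenko matrix. *)
Lemma SP_action (f : 'I_n -> bool -> {poly int}) : (p <= n)%N ->
  (S_mx n p *m P_mx n p) *m \col_i bracket 'X finset.set0 (row_set i) f =
  \col_i bracket 'X (row_endpoints i) (row_inner i) f.
Proof.
move=> pn; pose g A := bracket 'X finset.set0 A f.
pose v r := \col_(x < n) g (circ_arc n r.+1 x.+1).
pose w r : 'cV_n := v r - 'X *: (if r is r'.+1 then v r' else const_mx (g finset.set0)).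
have -> : \col_i bracket 'X finset.set0 (row_set i) f =
    col_mx (g finset.set0)%:M (\mxcol_(r < p) v r).
  apply/matrixP => i j; rewrite !mxE /row_set ord1.
  by case: fintype.split => k; rewrite !mxE // ord1 eqxx.
(* The entries of [w r] as a periodic function on all naturals, the form that [mul_cyclic_mx]
   shifts. *)
pose h r x := g (circ_arc n r.+1 x.+1) -
   'X * (if r is r'.+1 then g (circ_arc n r'.+1 x.+1) else g finset.set0).
have Cw r : cyclic_mx n *m w r = \col_x h r x.+1.
  have -> : w r = \col_x h r x.
    by apply/matrixP => a b; rewrite !mxE /h; case: r => [|r]; rewrite !mxE.
  rewrite (mul_cyclic_mx (h := h r)) // => y.
  by rewrite /h; case: r => [|r]; rewrite !circ_arc_modS.
rewrite -mulmxA.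
apply: etrans (congr1 (mulmx _) (P_mx_action p (g finset.set0) v)) _.
rewrite (S_mx_action p _ w).
apply/matrixP => i j; rewrite !mxE /row_endpoints /row_inner ord1.
case: fintype.split => k; rewrite !mxE; first by rewrite ord1 eqxx.
have rn : (tagnat.sig1 k < n)%N by rewrite (leq_trans (ltn_ord _)).
rewrite (bracket_row _ _ _ rn) -/g; move: (tagnat.sig1 k) rn (tagnat.sig2 k) => [].
case=> [|r] /= _ _ x; first by rewrite !mxE arc0.
by rewrite Cw !mxE /h; case: r => [|r] //; rewrite arc0.
Qed.

Lemma row_setE i : row_set i = row_endpoints i :|: row_inner i.
Proof.
rewrite /row_set /row_endpoints /row_inner.
by case: fintype.split => k; rewrite ?arc_endpoints ?finset.setU0.
Qed.

(** For two arcs this is [arc_cross]. The empty set of row 0 contains no end of an arc. *)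
Lemma row_set_cross i j : (p.*2 <= n.+1)%N ->
  row_endpoints i \subset row_set j -> row_endpoints j \subset row_set i -> i = j.
Proof.
move=> pn; rewrite -{3}(splitK i) -{3}(splitK j) /row_endpoints /row_set.
case: fintype.split => [a|k]; case: fintype.split => [b|l].
- by rewrite !ord1.
- by move=> _ /fintype.subsetP/(_ (inZp (tagnat.sig2 l).+1)); rewrite !inE eqxx => /(_ isT).
- by move=> /fintype.subsetP/(_ (inZp (tagnat.sig2 k).+1)); rewrite !inE eqxx => /(_ isT).
move=> /fintype.subsetP kl /fintype.subsetP lk.
have [] := @arc_cross m (tagnat.sig1 k) (tagnat.sig1 l)
             (tagnat.sig2 k).+1 (tagnat.sig2 l).+1.
- by have := ltn_ord (tagnat.sig1 k); have := ltn_ord (tagnat.sig1 l); lia.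
- by apply: kl; rewrite !inE eqxx.
- by apply: kl; rewrite !inE eqxx orbT.
- by apply: lk; rewrite !inE eqxx.
- by apply: lk; rewrite !inE eqxx orbT.
move=> r_eq x_eq; congr (unsplit (inr _)).
(* Starting lines lie between 1 and [n], so their residues determine them. *)
have {}x_eq : tagnat.sig2 k = tagnat.sig2 l :> nat.
  move/(congr1 val): x_eq => /= /eqP.
  rewrite -[(tagnat.sig2 k).+1]addn1 -[(tagnat.sig2 l).+1]addn1 eqn_modDr.
  by rewrite !modn_small ?ltn_ord // => /eqP.
apply: val_inj; rewrite /= (tagnat.rect k) (tagnat.rect l) x_eq.
by congr (_ + _)%N; apply: eq_bigl => z; rewrite r_eq.
Qed.

Lemma row_gram i j : (p.*2 <= n.+1)%N ->
  gram 'X (row_endpoints i) (row_inner i) (row_endpoints j) (row_inner j) =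
  if i == j then (1 - 'X^2) ^+ #|row_endpoints i| else 0 :> {poly int}.
Proof.
move=> pn; case: eqVneq => [->|ij]; first exact: gram_diag.
have [sub_ij|] := boolP (row_endpoints i \subset row_set j); last first.
  case/fintype.subsetPn => k ki; rewrite row_setE finset.in_setU negb_or => /andP[].
  exact: gram_eq0.
have [sub_ji|] := boolP (row_endpoints j \subset row_set i); last first.
  case/fintype.subsetPn => k ki; rewrite row_setE finset.in_setU negb_or => /andP[].
  exact: gram_eq0r.
by rewrite (row_set_cross pn sub_ij sub_ji) eqxx in ij.
Qed.

(** As a function of the index the count is nondecreasing, which yields the divisibility of
    successive diagonal entries. *)
Lemma card_row_endpoints i : (p <= n)%N ->
  #|row_endpoints i| = if (i < 1)%N then 0%N else if (i < n.+1)%N then 1%N else 2%N.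
Proof.
move=> pn; rewrite /row_endpoints; case: splitP => k; first by rewrite cards0.
move=> ->.
rewrite card_endpoints ?(leq_trans (ltn_ord _) pn) // ltnS tagnat.rect /=.
case: (posnP (tagnat.sig1 k)) => [->|r_gt0].
  by rewrite big_pred0_eq add0n ltn_ord.
have p0 : (0 < p)%N by apply: leq_ltn_trans (ltn_ord (tagnat.sig1 k)).
by rewrite (bigD1 (Ordinal p0)) //= -addnA ltnNge leq_addr.
Qed.

(** The exponents 0, 1, 2 of the diagonal blocks count the ends of [R_0], of one-line arcs and of
    longer arcs. *)
Lemma snf_mxE i j : (p <= n)%N ->
  snf_mx n p i j = if i == j then (1 - 'X^2) ^+ #|row_endpoints i| else 0.
Proof.
move=> pn; rewrite -[in LHS](splitK i) -[in LHS](splitK j).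
rewrite -(inj_eq (can_inj (@splitK _ _))) /row_endpoints /snf_mx.
case: fintype.split => [a|k]; case: fintype.split => [b|l].
- by rewrite block_mxEul !ord1 !mxE eqxx cards0 expr0.
- by rewrite block_mxEur mxE.
- by rewrite block_mxEdl mxE.
have -> : (inr k == inr l :> 'I_1 + _) = (k == l) by [].
rewrite block_mxEdr card_endpoints ?(leq_trans (ltn_ord _) pn) // mxE.
have [->|kl] := eqVneq k l.
  rewrite eqxx conform_mx_id mxE eqxx.
  by case: (tagnat.sig1 l == 0%N :> nat).
case: eqVneq => [e|]; last by rewrite mxE.
rewrite e conform_mx_id mxE; case: (eqVneq (tagnat.sig2 k)) => // e2; case/eqP: kl.
by apply: val_inj; rewrite /= (tagnat.rect k) (tagnat.rect l) e e2.
Qed.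

Lemma SP_gram : (p.*2 <= n.+1)%N -> 
  let V : 'M[{poly int}]_N := \matrix_(i, j)
    'X^#|(row_set i :\: row_set j) :|: (row_set j :\: row_set i)| in
  snf_mx n p = (S_mx n p *m P_mx n p) *m V *m (S_mx n p *m P_mx n p)^T.
Proof.
move=> pn V; have pn' : (p <= n)%N by lia.
set U := (S_mx n p *m P_mx n p).
have UV i j : (U *m V) i j =
  bracket 'X (row_endpoints i) (row_inner i) (fun k b => overlap 'X b (k \in row_set j)).
  have := SP_action (fun k b => overlap 'X b (k \in row_set j)) pn'.
  move=> /matrixP/(_ i 0); rewrite mxE [RHS]mxE => <-.
  rewrite mxE; apply: eq_bigr => l _; rewrite !mxE -prod_overlap.
  congr (_ * _); apply: eq_bigr => k _.
  by rewrite /bracket_factor finset.in_set0.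
(* As a function of [l], the entry [(U *m V) i l] is again a product over the lines of weights
   depending only on membership in [row_set l], so [SP_action] applies a second time. *)
have UVU i j : (U *m V *m U^T) i j =
  gram 'X (row_endpoints j) (row_inner j) (row_endpoints i) (row_inner i).
  have := SP_action (fun k b => bracket_factor 'X (row_endpoints i) (row_inner i)
            (fun _ c => overlap 'X c b) k) pn'.
  move=> /matrixP/(_ j 0); rewrite mxE [RHS]mxE /gram => <-.
  rewrite mxE; apply: eq_bigr => l _; rewrite UV !mxE mulrC.
  congr (_ * _); apply: eq_bigr => k _.
  by rewrite /bracket_factor finset.in_set0.
apply/matrixP => i j; rewrite UVU row_gram // snf_mxE // eq_sym.
by case: eqVneq => // ->.
Qed.

Lemma snf_mx_dvd i j : (p <= n)%N -> j = i.+1 :> nat ->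
  exists e, snf_mx n p j j = e * snf_mx n p i i.
Proof.
move=> pn ji; rewrite !snf_mxE // !eqxx.
exists ((1 - 'X^2) ^+ (#|row_endpoints j| - #|row_endpoints i|)).
rewrite -exprD subnK // !card_row_endpoints // ji.
by case: (i : nat) => //= r; rewrite !ltnS; case: (ltnP r m) => [/ltnW ->|_] //; case: ifP.
Qed.

End Gram.

(** * Regions as sign classes *)

Section Plane.
Variable R : realType.
Local Notation plane := (R * R)%type.
Local Open Scope classical_set_scope.
Implicit Types (a b x y : plane) (A : set plane).

Lemma orient_convex a b x y (t : R) :
  orient a b ((1 - t) * x.1 + t * y.1, (1 - t) * x.2 + t * y.2) =
  (1 - t) * orient a b x + t * orient a b y.
Proof. by rewrite /orient /=; ring. Qed.

Lemma continuous_orient a b : continuous (orient a b).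
Proof.
move=> x; apply: cvgB; apply: cvgM; try exact: cvg_cst.
  by apply: cvgB; [exact: cvg_snd | exact: cvg_cst].
by apply: cvgB; [exact: cvg_fst | exact: cvg_cst].
Qed.

(** Intermediate values: the image of [A] is an interval that avoids 0. *)
Lemma connected_orient_sign a b A x y : connected A -> A x -> A y ->
  (forall z, A z -> orient a b z != 0) -> (0 < orient a b x) = (0 < orient a b y).
Proof.
move=> cA Ax Ay nz.
have cI : is_interval (orient a b @` A).
  apply/connected_intervalP; apply: connected_continuous_connected => //.
  by apply: continuous_subspaceT; apply: continuous_orient.
have pos_trans u v : A u -> A v -> 0 < orient a b u -> 0 < orient a b v.
  move=> Au Av u0; rewrite lt_neqAle eq_sym nz //= leNgt; apply/negP => v0.
  have Iv : (orient a b @` A) (orient a b v) by exists v.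
  have Iu : (orient a b @` A) (orient a b u) by exists u.
  have vu : orient a b v <= 0 <= orient a b u by rewrite (ltW v0) (ltW u0).
  have [z Az z0] := cI _ _ Iv Iu 0 vu.
  by have := nz _ Az; rewrite z0 eqxx.
by apply/idP/idP; apply: pos_trans.
Qed.

Lemma connected_segment x y :
  connected [set z | exists2 t, 0 <= t <= 1 &
    z = ((1 - t) * x.1 + t * y.1, (1 - t) * x.2 + t * y.2)].
Proof.
pose f (t : R) : plane := ((1 - t) * x.1 + t * y.1, (1 - t) * x.2 + t * y.2).
have -> : [set z | exists2 t, 0 <= t <= 1 & z = f t] = f @` `[0, 1].
  by apply/seteqP; split=> z [t t01 zt]; exists t => //; rewrite /= in_itv in t01 *.
apply: connected_continuous_connected; first exact: segment_connected.
apply: continuous_subspaceT => t.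
have affine_cvg (u v : R) : ((1 - s) * u + s * v) @[s --> t] --> (1 - t) * u + t * v.
  apply: cvgD; apply: cvgM; try exact: cvg_cst; try exact: cvg_id.
  by apply: cvgB; [exact: cvg_cst|exact: cvg_id].
exact: cvg_pair (affine_cvg x.1 y.1) (affine_cvg x.2 y.2).
Qed.

End Plane.

Lemma convex_neq0 (R : realFieldType) (t u v : R) : 0 <= t <= 1 ->
  u != 0 -> v != 0 -> (v < 0) = (u < 0) -> (1 - t) * u + t * v != 0.
Proof.
have pos (a b : R) : 0 <= t <= 1 -> 0 < a -> 0 < b -> 0 < (1 - t) * a + t * b.
  move=> /andP[]; rewrite le_eqVlt => /orP[/eqP <-|t0] t1 a0 b0.
    by rewrite subr0 mul1r mul0r addr0.
  by rewrite ltr_wpDl ?mulr_gt0 ?mulr_ge0 ?subr_ge0 ?(ltW a0).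
move=> t01 u0 v0; case: (ltgtP u 0) u0 => // u0 _; case: (ltgtP v 0) v0 => // v0 _ _.
  by rewrite -oppr_eq0 opprD -!mulrN gt_eqF // pos ?oppr_gt0.
by rewrite gt_eqF // pos.
Qed.

Section Cells.
Variables (R : realType) (n : nat) (c : R * R) (rho theta : R).
Local Notation plane := (R * R)%type.
Local Open Scope classical_set_scope.
Implicit Types (x y : plane) (A B : {set 'I_n}).
Local Notation side k := (orient (vertex n c rho theta k) (vertex n c rho theta k.+1)).
Local Notation compl := (complement n c rho theta).
Local Notation sep := (sep n c rho theta).

(** [A] collects the lines seen from their negative side. For positive [rho] this is the side away
    from the polygon, as the vertices run counter-clockwise. *)
Definition cell A : set plane :=
  [set x | forall k : 'I_n, side k x != 0 /\ (side k x < 0) = (k \in A)].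

Definition beyond x : {set 'I_n} := [set k : 'I_n | side k x < 0]%SET.

Lemma complementP x : compl x <-> forall k : 'I_n, side k x != 0.
Proof.
split=> [xc k|xc [k /= kn]]; last by move/eqP; apply/negP; apply: (xc (Ordinal kn)).
by apply/eqP => x0; apply: xc; exists k => //=; apply: ltn_ord.
Qed.

Lemma cell_complement A : cell A `<=` compl.
Proof. by move=> x xA; apply/complementP => k; have [] := xA k. Qed.

Lemma cell_beyond A x : cell A x -> beyond x = A.
Proof. by move=> xA; apply/finset.setP => k; rewrite inE; have [] := xA k. Qed.

Lemma mem_cell_beyond x : compl x -> cell (beyond x) x.
Proof. by move=> /complementP xc k; rewrite inE. Qed.

(** Signs are constant on a component. Conversely, a point of the same sign class is joined to [x]
    by a segment that meets no line. *)
Lemma region_cell x : compl x -> connected_component compl x = cell (beyond x).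
Proof.
move=> xc; apply/seteqP; split=> y.
  move=> xy k.
  have yc := connected_component_sub xy.
  split; first by move/complementP: yc; apply.
  rewrite inE !ltNge !le_eqVlt ![0 == _]eq_sym.
  have /negPf -> /= := (complementP y).1 yc k.
  have /negPf -> /= := (complementP x).1 xc k; congr (~~ _).
  apply: (connected_orient_sign (component_connected (A := compl) (x := x))) => //.
    exact: connected_component_refl.
  by move=> z /connected_component_sub/complementP; apply.
move=> yA; pose S := [set z | exists2 t, 0 <= t <= 1 &
    z = ((1 - t) * x.1 + t * y.1, (1 - t) * x.2 + t * y.2)].
apply: (connected_component_max (B := S)).
- exists 0; first by rewrite lexx ler01.
  by rewrite subr0 !mul1r !mul0r !addr0 -surjective_pairing.
- move=> z [t /andP[t0 t1] ->]; apply/complementP => k; rewrite orient_convex.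
  have [ynz] := yA k; rewrite inE => xy.
  by apply: convex_neq0; rewrite ?t0 //; apply: (complementP x).1.
- exact: connected_segment.
- exists 1; first by rewrite lexx ler01.
  by rewrite subrr !mul1r !mul0r !add0r -surjective_pairing.
Qed.

Lemma region_cellP C : regions n c rho theta C ->
  exists2 A, C = cell A & cell A !=set0.
Proof.
move=> [x xc ->]; exists (beyond x); first exact: region_cell.
by exists x; apply: mem_cell_beyond.
Qed.

Lemma cell_region A : cell A !=set0 -> regions n c rho theta (cell A).
Proof.
move=> [x xA]; exists x; first exact: cell_complement xA.
by rewrite region_cell ?(cell_beyond xA) //; apply: cell_complement xA.
Qed.

Lemma cell_inj A B : cell A !=set0 -> cell A = cell B -> A = B.
Proof.
by move=> [x xA] AB; rewrite -(cell_beyond xA); apply: cell_beyond; rewrite -AB.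
Qed.

(** [separates] is stated by inclusions; the points [x] and [y] exclude the vacuous cases. *)
Lemma sep_cell A B : cell A !=set0 -> cell B !=set0 ->
  sep (cell A) (cell B) = (A :\: B) :|: (B :\: A).
Proof.
move=> [x xA] [y yB]; apply/finset.setP => k; rewrite !inE.
have cell_side C z : cell C z -> if k \in C then side k z < 0 else 0 < side k z.
  by move=> /(_ k) [nz <-]; case: ltgtP nz.
apply/asboolP/idP => [|].
  have [[_ <-] [_ <-]] := (xA k, yB k).
  by case=> -[/(_ x xA) /= kx /(_ y yB) /= ky]; rewrite ?kx ?ky lt_gtF.
case kA: (k \in A); case kB: (k \in B) => //= _.
  by right; split=> z /cell_side; rewrite ?kA ?kB.
by left; split=> z /cell_side; rewrite ?kA ?kB.
Qed.

(** A labelling only prescribes separation from [R_0]; with [C] as [R_0] this recovers all other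
    pairs. *)
Lemma sep_regions C D E :
    regions n c rho theta C -> regions n c rho theta D -> regions n c rho theta E ->
  sep D E = (sep C D :\: sep C E) :|: (sep C E :\: sep C D).
Proof.
move=> /region_cellP[A0 -> A00] /region_cellP[A -> An0] /region_cellP[B -> Bn0].
rewrite !sep_cell //; apply/finset.setP => k; rewrite !inE.
by case: (k \in A0); case: (k \in A); case: (k \in B).
Qed.

End Cells.

(** * The arrangement in polar coordinates *)

Section Trigonometry.
Variable R : realType.
Implicit Types (x u v b w : R).

(** The angle is [acos (u / r)] up to sign: the squares fix the sine up to sign, and negating the
    angle corrects it. *)
Lemma polar_coordinates u v : exists r phi : R,
  [/\ 0 <= r, u = r * cos phi & v = r * sin phi].
Proof.
pose r := Num.sqrt (u ^+ 2 + v ^+ 2).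
have r0 : 0 <= r by apply: sqrtr_ge0.
have rE : r ^+ 2 = u ^+ 2 + v ^+ 2 by rewrite sqr_sqrtr // addr_ge0 ?sqr_ge0.
have [r_eq0|r_neq0] := eqVneq r 0.
  exists 0, 0; rewrite !mul0r lexx; move: rE; rewrite r_eq0 expr0n /= => /esym/eqP.
  by rewrite paddr_eq0 ?sqr_ge0 // !sqrf_eq0 => /andP[/eqP -> /eqP ->].
have r_gt0 : 0 < r by rewrite lt_neqAle eq_sym r_neq0.
have ur : -1 <= u / r <= 1.
  rewrite -ler_norml -(@ler_pXn2r _ 2%N) ?nnegrE // expr1n real_normK ?num_real // expr_div_n.
  by rewrite ler_pdivrMr ?exprn_gt0 // mul1r rE lerDl sqr_ge0.
have cu : r * cos (acos (u / r)) = u.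
  by rewrite acosK ?in_itv //= mulrCA mulfV // mulr1.
have su : (r * sin (acos (u / r))) ^+ 2 = v ^+ 2.
  by rewrite exprMn sin2cos2 mulrBr mulr1 -exprMn cu rE addrAC subrr add0r.
have [vE|vE] : v = r * sin (acos (u / r)) \/ v = r * sin (- acos (u / r)).
  move/eqP: su; rewrite eqf_sqr => /orP[/eqP <-|/eqP suN]; first by left.
  by right; rewrite sinN mulrN suN opprK.
- by exists r, (acos (u / r)); rewrite cu.
- by exists r, (- acos (u / r)); rewrite cosN cu.
Qed.

Lemma cosD2piz x (z : int) : cos (x + 2 * pi * z%:~R) = cos x.
Proof.
have nat_case (y : R) (k : nat) : cos (y + 2 * pi * k%:R) = cos y.
  rewrite -[RHS](periodicn (@cosD2pi R) k y); congr (cos (_ + _)).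
  by rewrite mulr_natr mulr_natl.
case: z => k; first exact: nat_case.
by rewrite NegzE mulrNz mulrN -[LHS](nat_case _ k.+1) subrK.
Qed.

Lemma sinD2piz x (z : int) : sin (x + 2 * pi * z%:~R) = sin x.
Proof. by rewrite -!cosBpihalf addrAC cosD2piz. Qed.

Lemma cos_near b w : b <= pi -> `|w| < b -> cos b < cos w.
Proof.
move=> bpi wb; have b0 : 0 <= b by rewrite ltW // (le_lt_trans _ wb).
rewrite -[cos w]cos_norm ltr_cos // in_itv /= ?b0 ?bpi //.
by rewrite normr_ge0 (le_trans (ltW wb)).
Qed.

Lemma cos_far b w : 0 <= b -> b <= w -> w <= 2 * pi - b -> cos w <= cos b.
Proof.
move=> b0.
have half y : b <= y -> y <= pi -> cos y <= cos b.
  move=> b_y ypi; have bI : b \in `[0, pi] by rewrite in_itv /= b0 (le_trans b_y).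
  have yI : y \in `[0, pi] by rewrite in_itv /= ypi (le_trans b0).
  by rewrite leNgt ltr_cos // -leNgt.
move=> bw wb; have [/(half _ bw) //|piw] := leP w pi.
(* Past [pi], the angle is reflected to [2 * pi - w]. *)
by rewrite -[cos w]cosN -(cosD2piz _ 1) mulr1 half //; lra.
Qed.

(** [N] is the ceiling of [w], replaced by 0 when negative. *)
Lemma nat_below w : exists N : nat, forall s : nat, (s < N)%N = (s%:R < w).
Proof.
have H (s : nat) : (s%:Z < Num.ceil w) = (s%:R < w) by rewrite ceil_gt_int.
case: (Num.ceil w) H => k H; first by exists k => s; rewrite -H ltz_nat.
by exists 0%N => s; rewrite -H.
Qed.

(** The integer in question is the floor of [w] plus 1. Dividing the floor by [n] and adding 1 to
    the remainder gives a representative from 1 to [n]. *)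
Lemma cyclic_floor (n : nat) w : (0 < n)%N -> exists (y : nat) (z : int),
  (1 <= y <= n)%N /\ w < y%:R + n%:R * z%:~R <= w + 1.
Proof.
move=> n0; pose f := Num.floor w.
have /andP[fw wf] := floor_itv w; rewrite -/f intrD in fw wf.
have n0' : (n%:Z != 0) by rewrite -lt0n.
have := modz_ge0 f n0'; have := ltz_pmod f (n0 : (0 < n%:Z)%R).
have fE := divz_eq f n; move: fE.
case: (f %% n)%Z => // s fE sn _; exists s.+1, (f %/ n)%Z.
split; first by rewrite /= -ltz_nat.
have -> : s.+1%:R + n%:R * ((f %/ n)%Z)%:~R = f%:~R + 1 :> R.
  by rewrite [in RHS]fE intrD intrM -natr1; ring.
by rewrite wf lerD2r.
Qed.

End Trigonometry.

(** * Lines beyond which a point lies *)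

Section RegularPolygon.
Variables (R : realType) (m : nat) (c : R * R) (rho theta : R).
Local Notation n := m.+1.
Hypotheses (hn : (3 <= n)%N) (hrho : 0 < rho).
Local Notation plane := (R * R)%type.
Local Notation side k := (orient (vertex n c rho theta k) (vertex n c rho theta k.+1)).
Implicit Types (x : plane) (k : nat).

(** Half the angle under which an edge is seen from the center. *)
Definition half_step : R := pi / n%:R.
Local Notation h := half_step.

(* The angle of the outward normal of the line of index [k]. *)
Definition edge_dir k : R := theta + (2 * k%:R + 1) * h.

(** Scalar product of [x - c] with the outward unit normal; on the line itself it equals the apothem
    [rho * cos h]. *)
Definition height k x : R :=
  (x.1 - c.1) * cos (edge_dir k) + (x.2 - c.2) * sin (edge_dir k).

Lemma half_stepE : n%:R * h = pi.
Proof. by rewrite mulrC divfK ?pnatr_eq0. Qed.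

Lemma half_step_gt0 : 0 < h.
Proof. by rewrite divr_gt0 ?pi_gt0 ?ltr0n. Qed.

Lemma three_half_step : 3 * h <= pi.
Proof.
by rewrite -half_stepE ler_wpM2r ?(ltW half_step_gt0) // ler_nat.
Qed.

Lemma cos_half_step_gt0 : 0 < cos h.
Proof.
by apply: cos_gt0_pihalf; have := half_step_gt0; have := three_half_step; lra.
Qed.

Lemma sin_half_step_gt0 : 0 < sin h.
Proof.
by apply: sin_gt0_pi; have := half_step_gt0; have := three_half_step; lra.
Qed.

Lemma vertex_angle k : theta + 2 * pi * k%:R / n%:R = edge_dir k - h.
Proof. by rewrite /edge_dir /half_step; ring. Qed.

Lemma vertex_angleS k : theta + 2 * pi * k.+1%:R / n%:R = edge_dir k + h.
Proof.
by rewrite /edge_dir /half_step -[k.+1%:R]natr1; ring.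
Qed.

(** The edge length [2 * rho * sin h] times the signed distance to the line, positive on the side of
    the center. *)
Lemma side_height k x :
  side k x = 2 * rho * sin h * (rho * cos h - height k x).
Proof.
rewrite /orient /vertex /= vertex_angleS vertex_angle /height.
rewrite cosB cosD sinB sinD.
have -> : rho * cos h = rho * cos h * (cos (edge_dir k) ^+ 2 + sin (edge_dir k) ^+ 2).
  by rewrite cos2Dsin2 mulr1.
ring.
Qed.

Lemma side_lt0 k x : (side k x < 0) = (rho * cos h < height k x).
Proof.
by rewrite side_height pmulr_rlt0 ?subr_lt0 // !mulr_gt0 ?sin_half_step_gt0.
Qed.

Lemma side_neq0 k x : (side k x != 0) = (height k x != rho * cos h).
Proof.
rewrite side_height mulf_eq0 negb_or subr_eq0 [_ == height _ _]eq_sym.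
by rewrite gt_eqF // !mulr_gt0 ?sin_half_step_gt0.
Qed.

Lemma polar_centred x : exists r phi : R, 0 <= r /\
  x = (c.1 + r * cos phi, c.2 + r * sin phi).
Proof.
have [r [phi [r0 e1 e2]]] := polar_coordinates (x.1 - c.1) (x.2 - c.2).
exists r, phi; rewrite -e1 -e2 [c.1 + _]addrC [c.2 + _]addrC !subrK.
by rewrite -surjective_pairing.
Qed.

Lemma height_polar k r phi :
  height k (c.1 + r * cos phi, c.2 + r * sin phi) = r * cos (edge_dir k - phi).
Proof. by rewrite /height /= cosB; ring. Qed.

(** Each line further turns the normal by [2 * h], and [n] of them make a full turn. *)
Lemma edge_dir_shift (k : 'I_n) (y : nat) :
  let s : nat := (k - inZp y : 'I_n)%R in
  exists z : int, edge_dir k = edge_dir y + 2 * s%:R * h + 2 * pi * z%:~R.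
Proof.
move=> s; have kE : k = ((y + s) %% n)%N :> nat.
  by rewrite -[in LHS](subrK (inZp y) k) /= addnC modnDml.
exists (- ((y + s) %/ n)%N%:Z).
have : (y + s)%:R = ((y + s) %/ n)%N%:R * n%:R + k%:R :> R.
  by rewrite -natrM -natrD kE -divn_eq.
rewrite /edge_dir natrD mulrNz -half_stepE => E.
have -> : k%:R = y%:R + s%:R - ((y + s) %/ n)%N%:R * n%:R :> R by rewrite E; ring.
by rewrite -pmulrn; ring.
Qed.

Lemma beyond_arc x (p : nat) : p = ((n + 1) %/ 2)%N ->
  exists r y, [/\ (r <= p)%N, (1 <= y <= n)%N
     & beyond n c rho theta x = circ_arc n r y].
Proof.
move=> hp; have h0 := half_step_gt0; have nh := half_stepE.
have [r [phi [r0 ->]]] := polar_centred x.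
have a0 : 0 < rho * cos h by rewrite mulr_gt0 ?cos_half_step_gt0.
have [ra|ar] := leP r (rho * cos h).
  (* In the inscribed disc no height exceeds the apothem. *)
  exists 0%N, 1%N; split=> //; rewrite arc0; apply/finset.setP => k.
  rewrite !inE side_lt0 height_polar ltNge; apply/negbTE; rewrite negbK.
  by apply: le_trans ra; rewrite ler_piMr ?cos_le1.
have rgt0 : 0 < r by apply: lt_trans ar.
have arI : 0 < rho * cos h / r < 1.
  by rewrite divr_gt0 //= ltr_pdivrMr // mul1r.
pose b := acos (rho * cos h / r).
have cb : cos b = rho * cos h / r by apply: acosK; rewrite in_itv /=; lra.
have b0 : 0 < b by rewrite acos_gt0 //; lra.
have bpi : b < pi / 2.
  have bI : b \in `[0, pi] by rewrite in_itv /= acos_ge0 ?acos_lepi //; lra.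
  have pI : (pi / 2 : R) \in `[0, pi] by rewrite in_itv /=; have := @pi_gt0 R; lra.
  by rewrite -ltr_cos // cos_pihalf cb; lra.
(* Line [y], counted with [z] full turns, is the first whose direction comes after [phi - b]; [t] is
   its angle relative to [phi]. *)
have [y [z [yn /andP[yz zy]]]] :=
  cyclic_floor ((phi - theta - h - b) / (2 * h)) (ltn0Sn m).
pose t := theta + h - phi + 2 * h * (y%:R + n%:R * z%:~R).
have h2 : 0 < 2 * h by rewrite mulr_gt0.
have t_gt : - b < t by move: yz; rewrite ltr_pdivrMr // /t; lra.
have t_le : t <= - b + 2 * h.
  move: zy; rewrite -lerBlDr ler_pdivlMr // /t; lra.
(* [N] counts the lines from [y] on whose relative angle stays below [b]. *)
have [N HN] := nat_below ((b - t) / (2 * h)).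
have {}HN s : (s < N)%N = (t + 2 * s%:R * h < b).
  rewrite HN ltr_pdivlMr // ltrBrDl; congr (_ + _ < _); ring.
(* The first and last of these directions are less than [2 * b < pi = n * h] apart, so twice [N - 1]
   is less than [n]. *)
have Np : (N <= p)%N.
  case: N HN => // N HN; have := HN N; rewrite ltnSn => /esym NB.
  have : N.*2%:R < n%:R :> R.
    rewrite -(ltr_pM2r h0) nh -mul2n natrM.
    by move: NB t_gt bpi; clear; clearbody t b; lra.
  by rewrite ltr_nat; move: hp; clear; lia.
have Nn : (N <= n)%N by move: Np hp; clear; lia.
exists N, y; split=> //; apply/finset.setP => k.
rewrite inE side_lt0 height_polar [r * _]mulrC -ltr_pdivrMr // -cb mem_arc //.
have [q ->] := edge_dir_shift k y.
have := ltn_ord (k - inZp y : 'I_n)%R; move: (nat_of_ord _) => s sn.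
rewrite HN.
have -> : edge_dir y + 2 * s%:R * h + 2 * pi * q%:~R - phi =
    t + 2 * s%:R * h + 2 * pi * (q - z)%:~R.
  by rewrite /t /edge_dir intrB -nh; ring.
rewrite cosD2piz.
have s0 : 0 <= 2 * s%:R * h.
  by apply: mulr_ge0 (ltW h0); apply: mulr_ge0; apply: ler0n.
have sle : 2 * s%:R * h + 2 * h <= 2 * pi.
  have : (s%:R + 1) * h <= pi by rewrite -nh ler_pM2r // natr1 ler_nat.
  by clear yz zy HN; lra.
move: (2 * s%:R * h) s0 sle => u s0 sle.
clear yz zy HN; clearbody t b.
(* Since [t <= - b + 2 * h] and [u <= 2 * pi - 2 * h], an angle past [b] never exceeds
   [2 * pi - b]. *)
have [wb|bw] := ltP (t + u) b.
  by rewrite cos_near //; [lra | rewrite ltr_norml wb andbT; lra].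
by apply/negbTE; rewrite -leNgt cos_far //; lra.
Qed.

Lemma cell_set0_neq0 : nonempty (cell c rho theta (finset.set0 : {set 'I_n})).
Proof.
exists c => k; rewrite side_neq0 side_lt0 /height !subrr !mul0r addr0 finset.in_set0.
have a0 : 0 < rho * cos h by rewrite mulr_gt0 ?cos_half_step_gt0.
by rewrite lt_eqF // ltNge ltW.
Qed.

Lemma cell_arc_neq0 (p r y : nat) : p = ((n + 1) %/ 2)%N -> (r <= p)%N ->
  nonempty (cell c rho theta (circ_arc n r y)).
Proof.
move=> hp rp; case: r rp => [|r] rp; first by rewrite arc0; apply: cell_set0_neq0.
have h0 := half_step_gt0; have nh := half_stepE.
have rn : (r.*2 < n)%N by lia.
have {}rn : 2 * r%:R + 1 <= n%:R :> R by rewrite -natrM natr1 ler_nat mul2n.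
have r0 : 0 <= r%:R :> R by [].
have rh0 : 0 <= r%:R * h by rewrite mulr_ge0 ?ler0n ?(ltW h0).
have rh : 2 * (r%:R * h) + h <= pi by rewrite -nh; nra.
(* The witness points in the middle direction of the arc, whose ends are at angle [r * h] and whose
   next lines are at [(r + 2) * h]. The extra quarter step separates these and keeps [b] below
   [pi / 2]; [d] makes [cos b] the ratio of the apothem to the radius. *)
pose b := (r%:R + 1 / 4) * h; pose phi := edge_dir y + r%:R * h.
have bE : b = r%:R * h + h / 4 by rewrite /b; ring.
have cb0 : 0 < cos b by apply: cos_gt0_pihalf; rewrite bE; lra.
have a0 : 0 < rho * cos h by rewrite mulr_gt0 ?cos_half_step_gt0.
pose d := rho * cos h / cos b.
have d0 : 0 < d by rewrite divr_gt0.
have dE : rho * cos h = d * cos b by rewrite /d divfK // gt_eqF.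
exists (c.1 + d * cos phi, c.2 + d * sin phi) => k.
rewrite side_neq0 side_lt0 height_polar dE ltr_pM2l //.
rewrite (inj_eq (mulfI (lt0r_neq0 d0))) mem_arc; last lia.
have [q ->] := edge_dir_shift k y.
have := ltn_ord (k - inZp y : 'I_n)%R; move: (nat_of_ord _) => s sn.
have -> : edge_dir y + 2 * s%:R * h + 2 * pi * q%:~R - phi =
    (2 * s%:R - r%:R) * h + 2 * pi * q%:~R by rewrite /phi; ring.
rewrite cosD2piz.
have [sr|rs] := ltnP s r.+1.
  have sr' : s%:R * h <= r%:R * h by rewrite ler_pM2r // ler_nat.
  have s0 : 0 <= s%:R * h by rewrite mulr_ge0 ?ler0n ?(ltW h0).
  have cw : cos b < cos ((2 * s%:R - r%:R) * h).
    by apply: cos_near; [rewrite bE; lra|rewrite ltr_norml bE; lra].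
  by rewrite cw gt_eqF.
have rs' : (r%:R + 1) * h <= s%:R * h by rewrite natr1 ler_pM2r // ler_nat.
have sn' : (s%:R + 1) * h <= pi by rewrite natr1 -nh ler_pM2r // ler_nat.
have cw : cos ((2 * s%:R - r%:R) * h) < cos b.
  (* [cos_far] is not strict, so it is applied with a slightly larger angle. *)
  apply: (@le_lt_trans _ _ (cos (b + h / 2))).
    by apply: cos_far; rewrite bE; lra.
  by apply: cos_near; [lra|rewrite ger0_norm; rewrite bE; lra].
by rewrite lt_eqF // ltNge ltW.
Qed.

End RegularPolygon.

(** * The labelling of the regions *)

Section PolygonInterior.
Variables (R : realType) (m : nat) (c : R * R) (rho theta : R).
Local Notation n := m.+1.
Hypotheses (hn : (3 <= n)%N) (hrho : 0 < rho).
Local Notation plane := (R * R)%type.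
Local Notation vert := (vertex n c rho theta).
Local Notation side k := (orient (vert k) (vert k.+1)).
Local Notation h := (half_step R m).
Local Notation dir := (edge_dir m theta).
Local Notation height := (height m c theta).
Implicit Types (x : plane) (k : nat).

Lemma vertexE k :
  vert k = (c.1 + rho * cos (theta + 2 * k%:R * h), c.2 + rho * sin (theta + 2 * k%:R * h)).
Proof.
rewrite /vertex vertex_angle.
have -> : dir k - h = theta + 2 * k%:R * h by rewrite /edge_dir; ring.
by [].
Qed.

Lemma vertex_mod k : vert (k %% n) = vert k.
Proof.
rewrite !vertexE [in RHS](divn_eq k n) natrD natrM.
have -> : theta + 2 * ((k %/ n)%N%:R * n%:R + (k %% n)%N%:R) * h =
    theta + 2 * (k %% n)%N%:R * h + 2 * pi * (k %/ n)%N%:Z%:~R.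
  by rewrite -(half_stepE R m) -pmulrn; ring.
by rewrite cosD2piz sinD2piz.
Qed.

(** Relative to the normal of line [k], a vertex sits at an odd multiple of [h], of absolute value
    between [h] and [2 * pi - h]; its height is thus at most the apothem. *)
Lemma side_vertex (j : 'I_n) (k : 'I_n) : 0 <= side k (vert j).
Proof.
rewrite leNgt side_lt0 // -leNgt vertexE height_polar ler_pM2l //.
have h0 := half_step_gt0 R m; have nh := half_stepE R m.
have jk : (2 * j%:R + 2 <= 2 * n%:R + 2 * k%:R :> R) /\ (2 * k%:R + 2 <= 2 * n%:R + 2 * j%:R :> R).
  by rewrite -!natrM -!natrD !ler_nat; have := ltn_ord j; have := ltn_ord k; lia.
rewrite -[cos (_ - _)]cos_norm /edge_dir.
have -> : theta + (2 * k%:R + 1) * h - (theta + 2 * j%:R * h) =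
   (2 * k%:R + 1 - 2 * j%:R) * h by ring.
rewrite normrM (gtr0_norm h0); apply: cos_far; first exact: ltW.
  rewrite ler_peMl ?(ltW h0) //.
  have [kj|jk'] := leqP j k.
    have kj' : j%:R <= k%:R :> R by rewrite ler_nat.
    by rewrite ger0_norm; lra.
  have jk'' : k%:R + 1 <= j%:R :> R by rewrite natr1 ler_nat.
  by rewrite ler0_norm; lra.
have -> : 2 * pi - h = (2 * n%:R - 1) * h by rewrite -nh; ring.
by rewrite ler_pM2r // ler_norml; lra.
Qed.

Lemma sum_fst (I : finType) (w : I -> R) (v : I -> plane) :
  (\sum_i w i *: v i).1 = \sum_i w i * (v i).1.
Proof. by rewrite (big_morph fst (id1 := 0) (op1 := +%R)). Qed.

Lemma sum_snd (I : finType) (w : I -> R) (v : I -> plane) :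
  (\sum_i w i *: v i).2 = \sum_i w i * (v i).2.
Proof. by rewrite (big_morph snd (id1 := 0) (op1 := +%R)). Qed.

Lemma orient_sum (a b : plane) (I : finType) (w : I -> R) (v : I -> plane) :
  \sum_i w i = 1 ->
  orient a b (\sum_i w i *: v i) = \sum_i w i * orient a b (v i).
Proof.
move=> w1; rewrite /orient sum_fst sum_snd.
have -> : \sum_i w i * (v i).2 - a.2 = \sum_i w i * ((v i).2 - a.2).
  under [RHS]eq_bigr do rewrite mulrBr.
  by rewrite sumrB -mulr_suml w1 mul1r.
have -> : \sum_i w i * (v i).1 - a.1 = \sum_i w i * ((v i).1 - a.1).
  under [RHS]eq_bigr do rewrite mulrBr.
  by rewrite sumrB -mulr_suml w1 mul1r.
by rewrite !mulr_sumr -sumrB; apply: eq_bigr => i _; ring.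
Qed.

Lemma side_polygon x (k : 'I_n) : polygon n c rho theta x -> 0 <= side k x.
Proof.
case=> w [w0 w1 ->]; rewrite orient_sum //; apply: sumr_ge0 => j _.
by rewrite mulr_ge0 // side_vertex.
Qed.

(** Multiplied by [2 * sin h], the sums of cosines and sines telescope and close up after a full
    turn. *)
Lemma sum_vertex :
  \sum_(k < n) (vert k).1 = n%:R * c.1 /\ \sum_(k < n) (vert k).2 = n%:R * c.2.
Proof.
have nh := half_stepE R m.
have sh : sin h != 0 by rewrite gt_eqF // sin_half_step_gt0.
have tel (f : R -> R) (F : R -> R) : (forall k : nat, 2 * sin h * f (theta + 2 * k%:R * h) =
     F (theta + 2 * k.+1%:R * h) - F (theta + 2 * k%:R * h)) ->
     F (theta + 2 * pi) = F theta -> \sum_(k < n) f (theta + 2 * k%:R * h) = 0.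
  move=> fF Fper; apply: (mulfI (_ : 2 * sin h != 0)); first by rewrite mulf_neq0.
  rewrite mulr_sumr mulr0; under eq_bigr do rewrite fF.
  rewrite -(big_mkord xpredT (fun k => F (theta + 2 * k.+1%:R * h) - F (theta + 2 * k%:R * h))).
  rewrite telescope_sumr // -mulrA nh Fper mulr0 mul0r addr0; exact: subrr.
have trig (k : nat) : theta + 2 * k.+1%:R * h - h = theta + 2 * k%:R * h + h.
  by rewrite -natr1; ring.
split.
  under eq_bigr do rewrite vertexE /=.
  rewrite big_split /= sumr_const card_ord -mulr_sumr (tel _ (fun u => sin (u - h))).
  - by rewrite mulr0 addr0 mulr_natl.
  - by move=> k; rewrite trig sinD sinB; ring.
  - by rewrite addrAC -[2 * pi]mulr1 -[1]/(1%:~R) sinD2piz.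
under eq_bigr do rewrite vertexE /=.
rewrite big_split /= sumr_const card_ord -mulr_sumr (tel _ (fun u => - cos (u - h))).
- by rewrite mulr0 addr0 mulr_natl.
- by move=> k; rewrite trig cosD cosB; ring.
- by rewrite addrAC -[2 * pi]mulr1 -[1]/(1%:~R) cosD2piz.
Qed.

(** The point lies in the sector of two consecutive vertices [k] and [k'], with coordinates [l] and
    [l'] relative to the center. The remaining weight [1 - l - l'] belongs to the center, the mean
    of the vertices, and is spread evenly over them. *)
Lemma cell_polygon x : cell c rho theta (finset.set0 : {set 'I_n}) x ->
  polygon n c rho theta x.
Proof.
move=> xin; have h0 := half_step_gt0 R m; have nh := half_stepE R m.
have h3 := three_half_step R hn.
have [r [phi [r0 xE]]] := polar_centred c x.
have [y [z [yn /andP[yz zy]]]] :=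
  cyclic_floor ((phi - theta) / (2 * h) - 1) (ltn0Sn m).
pose t := phi - theta - 2 * h * (y%:R + n%:R * z%:~R).
have h2 : 0 < 2 * h by rewrite mulr_gt0.
have t0 : 0 <= t by move: zy; rewrite subrK ler_pdivlMr // /t; lra.
have th : t < 2 * h.
  by move: yz; rewrite ltrBlDr ltr_pdivrMr // /t; lra.
have yl : (y %% n < n)%N by apply: ltn_pmod.
have ySl : (y.+1 %% n < n)%N by apply: ltn_pmod.
pose k : 'I_n := Ordinal yl; pose k' : 'I_n := Ordinal ySl.
have s2h : 0 < sin (2 * h) by apply: sin_gt0_pi; lra.
(* Cramer's rule for [x - c] in the basis of the two vertex vectors, at angles [- t] and [2 * h - t]
   from it. *)
pose l := r * sin (2 * h - t) / (rho * sin (2 * h)).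
pose l' := r * sin t / (rho * sin (2 * h)).
have l0 : 0 <= l.
  by rewrite divr_ge0 ?mulr_ge0 ?(ltW hrho) ?(ltW s2h) // sin_ge0_pi //; lra.
have l'0 : 0 <= l'.
  by rewrite divr_ge0 ?mulr_ge0 ?(ltW hrho) ?(ltW s2h) // sin_ge0_pi //; lra.
have vk : vert k = (c.1 + rho * cos (phi - t), c.2 + rho * sin (phi - t)).
  rewrite vertex_mod vertexE.
  have -> : phi - t = theta + 2 * y%:R * h + 2 * pi * z%:~R by rewrite /t -nh; ring.
  by rewrite cosD2piz sinD2piz.
have vk' : vert k' = (c.1 + rho * cos (phi + (2 * h - t)), c.2 + rho * sin (phi + (2 * h - t))).
  rewrite vertex_mod vertexE.
  have -> : phi + (2 * h - t) = theta + 2 * y.+1%:R * h + 2 * pi * z%:~R.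
    by rewrite /t -nh -natr1; ring.
  by rewrite cosD2piz sinD2piz.
(* The sum is the height of [x] over line [k] divided by the apothem. *)
have ll' : l + l' <= 1.
  have ch := cos_half_step_gt0 R hn; have sh := sin_half_step_gt0 R hn.
  have [_] := xin k; rewrite finset.in_set0 => /negbT.
  rewrite side_lt0 // -leNgt xE height_polar.
  have := edge_dir_shift theta k y; have -> : (k - inZp y : 'I_n) = 0.
    by rewrite (_ : k = inZp y) ?subrr //; apply: val_inj.
  case=> q ->; rewrite mulr0 mul0r addr0.
  have -> : dir y + 2 * pi * q%:~R - phi = h - t + 2 * pi * (q - z)%:~R.
    by rewrite /t /edge_dir intrB -nh; ring.
  rewrite cosD2piz => xle.
  have -> : l + l' = r * cos (h - t) / (rho * cos h).
    rewrite /l /l' -mulrDl -mulrDr.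
    have -> : sin (2 * h - t) + sin t = 2 * sin h * cos (h - t).
      have -> : 2 * h - t = h + (h - t) by ring.
      have {2}-> : t = h - (h - t) by ring.
      by move: (h - t) => u; rewrite sinD sinB; ring.
    have -> : sin (2 * h) = 2 * sin h * cos h.
      have -> : 2 * h = h + h by ring.
      by rewrite sinD; ring.
    field.
    by rewrite !gt_eqF.
  by rewrite ler_pdivrMr ?mul1r // mulr_gt0.
have sum1 (i : 'I_n) (f : 'I_n -> R) : \sum_j (j == i)%:R * f j = f i.
  rewrite (bigD1 i) //= eqxx mul1r big1 ?addr0 // => j /negPf ->.
  by rewrite mul0r.
pose w (j : 'I_n) := l * (j == k)%:R + l' * (j == k')%:R + (1 - l - l') / n%:R.
have sumw (f : 'I_n -> R) : \sum_j w j * f j =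
    l * f k + l' * f k' + (1 - l - l') / n%:R * \sum_j f j.
  rewrite -(sum1 k f) -(sum1 k' f) !mulr_sumr -!big_split /=.
  by apply: eq_bigr => j _; rewrite /w; ring.
have n_neq0 : n%:R != 0 :> R by rewrite pnatr_eq0.
have lE : rho * l * sin (2 * h) = r * sin (2 * h - t).
  by rewrite /l; field; rewrite !gt_eqF.
have l'E : rho * l' * sin (2 * h) = r * sin t.
  by rewrite /l'; field; rewrite !gt_eqF.
have s2hE : sin (2 * h) = sin (2 * h - t) * cos t + cos (2 * h - t) * sin t.
  by rewrite -sinD; congr sin; ring.
have [sv1 sv2] := sum_vertex.
exists w; split.
- move=> j; apply: addr_ge0; first by apply: addr_ge0; apply: mulr_ge0; rewrite ?ler0n.
  by apply: divr_ge0; rewrite ?ler0n // -addrA -opprD subr_ge0.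
- have := sumw (fun=> 1); under eq_bigr do rewrite mulr1.
  by move=> ->; rewrite sumr_const card_ord; field.
rewrite [RHS]surjective_pairing sum_fst sum_snd !sumw sv1 sv2 vk vk' xE /=.
congr (_, _).
  have -> : r * cos phi = rho * (l * cos (phi - t) + l' * cos (phi + (2 * h - t))).
    apply: (mulIf (lt0r_neq0 s2h)).
    transitivity (rho * l * sin (2 * h) * cos (phi - t) +
                  rho * l' * sin (2 * h) * cos (phi + (2 * h - t))); last by ring.
    by rewrite lE l'E s2hE cosB cosD; ring.
  by field.
have -> : r * sin phi = rho * (l * sin (phi - t) + l' * sin (phi + (2 * h - t))).
  apply: (mulIf (lt0r_neq0 s2h)).
  transitivity (rho * l * sin (2 * h) * sin (phi - t) +
                rho * l' * sin (2 * h) * sin (phi + (2 * h - t))); last by ring.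
  by rewrite lE l'E s2hE sinB sinD; ring.
by field.
Qed.

End PolygonInterior.

(** * Interior of the polygon, and regions as arcs *)

Section Labelling.
Variables (R : realType) (m : nat) (c : R * R) (rho theta : R).
Local Notation n := m.+1.
Hypotheses (hn : (3 <= n)%N) (hrho : 0 < rho).
Local Notation plane := (R * R)%type.
Local Notation vert := (vertex n c rho theta).
Local Notation side k := (orient (vert k) (vert k.+1)).
Local Notation regions := (regions n c rho theta).
Local Notation cell := (cell c rho theta (n := n)).
Local Open Scope classical_set_scope.

Lemma cell_set0P (x : plane) :
  cell finset.set0 x <-> forall k : 'I_n, 0 < side k x.
Proof.
split=> xin k; first by have [nz] := xin k; rewrite finset.in_set0; case: ltgtP nz.
by rewrite finset.in_set0 gt_eqF // lt_gtF.
Qed.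

(** If an interior point were on a line, a small step along the outward normal would stay in the
    polygon and make the side negative. Conversely, finitely many open half-planes form a
    neighbourhood contained in the polygon. *)
Lemma interior_polygon : interior (polygon n c rho theta) = cell finset.set0.
Proof.
apply/seteqP; split=> x.
  move=> xP; apply/cell_set0P => k; rewrite lt_neqAle side_polygon //; last first.
    exact: interior_subset xP.
  rewrite andbT; apply/negP => /eqP side0.
  pose d := edge_dir m theta k.
  have affine_cvg (u a : R) : (u + e * a) @[e --> (0 : R)] --> u.
    rewrite -[X in _ --> X]addr0 -[X in _ --> _ + X](mul0r a).
    apply: cvgD; first exact: cvg_cst.
    by apply: cvgM; [exact: cvg_id|exact: cvg_cst].
  have zcvg : (x.1 + e * cos d, x.2 + e * sin d) @[e --> (0 : R)] --> x.
    rewrite [X in _ --> X]surjective_pairing.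
    exact: cvg_pair (affine_cvg _ _) (affine_cvg _ _).
  have /nbhs_ballP[e /= e0 eP] := zcvg _ xP.
  have e2_ball : ball (0 : R) e (e / 2).
    by rewrite /ball /= sub0r normrN ger0_norm ?divr_ge0 ?ltW //; lra.
  have := side_polygon hn hrho k (eP _ e2_ball) => /=.
  suff -> : side k (x.1 + e / 2 * cos d, x.2 + e / 2 * sin d) =
      side k x - 2 * rho * sin (half_step R m) * (e / 2).
    have sh := sin_half_step_gt0 R hn.
    by rewrite -side0 sub0r oppr_ge0 leNgt !mulr_gt0 ?invr_gt0.
  rewrite !side_height /height -/d /=.
  have e2E : e / 2 = e / 2 * (cos d ^+ 2 + sin d ^+ 2) by rewrite cos2Dsin2 mulr1.
  by rewrite [X in _ = _ - _ * X]e2E; ring.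
move=> /cell_set0P xin.
have near_side (k : 'I_n) : nbhs x [set y | 0 < side k y].
  exact: (cvgr_gt _ (@continuous_orient _ (vert k) (vert k.+1) x) _ (xin k)).
have := @filter_forall _ _ _ _ (nbhs_filter x) near_side.
by apply: filterS => y yin; apply: cell_polygon => //; exact/cell_set0P.
Qed.

(** Dividing [k'] by [n] recovers [r - 1] and [x - 1] from the index [(r - 1) * n + x]. *)
Definition region_of (k : nat) : set plane :=
  if k is k'.+1 then cell (circ_arc n (k' %/ n).+1 (k' %% n).+1) else cell finset.set0.

Lemma region_ofE r x : (1 <= r)%N -> (1 <= x <= n)%N ->
  region_of ((r - 1) * n + x) = cell (circ_arc n r x).
Proof.
case: r x => // r [|x] // _ xn; rewrite subn1 addnS /= divnMDl // modnMDl.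
by rewrite divn_small // modn_small // addn0.
Qed.

Lemma circ_arc_inj r r' x x' : (r + r' < n)%N ->
  circ_arc n r.+1 x = circ_arc n r'.+1 x' -> r = r' /\ inZp x = inZp x' :> 'I_n.
Proof.
move=> rr arcE.
have ends s y : (inZp y : 'I_n) \in circ_arc n s.+1 y /\
    (inZp (y + s) : 'I_n) \in circ_arc n s.+1 y.
  by rewrite {1}arcSl arcSr !finset.in_setU1 !eqxx.
move: (ends r x) (ends r' x'); rewrite arcE => -[x1 x2] [y1 y2].
by apply: arc_cross; rewrite // arcE.
Qed.

(** Cells of arcs are nonempty by [cell_arc_neq0], pairwise distinct by [circ_arc_inj], and exhaust
    the regions by [beyond_arc]. *)
Lemma region_of_labelling (p : nat) : p = ((n + 1) %/ 2)%N ->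
  region_labelling n c rho theta p region_of.
Proof.
move=> hp.
have index_div k : (k < n * p)%N -> (k %/ n < p)%N by rewrite ltn_divLR // mulnC.
have cell0 : nonempty (cell finset.set0) by apply: cell_set0_neq0.
split=> [||r x /andP[r1 rp] xn].
- split.
  + move=> [|k] /= kn; apply: cell_region => //.
    by apply: cell_arc_neq0 hp _ => //; apply: index_div.
  + have arc_neq0 r x : circ_arc n r.+1 x <> finset.set0.
      move=> /finset.setP/(_ (inZp x)).
      by rewrite arcSl finset.in_setU1 eqxx finset.in_set0.
    move=> [|i] [|j] //; rewrite !inE /= => iN jN E.
    * by have /esym/arc_neq0 := cell_inj cell0 E.
    * by have /esym/arc_neq0 := cell_inj cell0 (esym E).
    have iC : nonempty (cell (circ_arc n (i %/ n).+1 (i %% n).+1)).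
      by apply: cell_arc_neq0 hp _ => //; apply: index_div.
    have := cell_inj iC E.
    case/circ_arc_inj; first by have := index_div _ iN; have := index_div _ jN; lia.
    move=> div_eq /(congr1 val) /= mod_eq; congr _.+1.
    rewrite (divn_eq i n) (divn_eq j n) div_eq; congr (_ + _)%N.
    move/eqP: mod_eq; rewrite -[(i %% n).+1]addn1 -[(j %% n).+1]addn1 eqn_modDr.
    by rewrite !modn_mod => /eqP.
  + move=> C /region_cellP[A -> [x xA]].
    have [r [y [rp yn]]] := beyond_arc c theta hn hrho x hp.
    rewrite (cell_beyond xA) => ->.
    case: r rp => [|r] rp; first by exists 0%N; rewrite //= arc0.
    exists ((r.+1 - 1) * n + y)%N; last exact: region_ofE.
    rewrite /= subn1 /= add1n ltnS; move: rp; case/andP: yn => _ yn rp.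
    by rewrite (leq_trans (leq_add (leqnn _) yn)) // -mulSnr mulnC leq_mul2l rp orbT.
- by rewrite interior_polygon.
rewrite region_ofE // sep_cell //; last exact: cell_arc_neq0 hp rp.
by rewrite finset.set0D finset.setD0 finset.set0U.
Qed.

(** The entries depend only on the separations from [R_0], so every labelling gives the same
    matrix. *)
Lemma varchenko_labelling (p : nat) (Reg : nat -> set plane) :
  region_labelling n c rho theta p Reg ->
  varchenko n c rho theta (1 + \sum_(r < p) n)%N Reg =
  \matrix_(i, j) 'X^#|(row_set i :\: row_set j) :|: (row_set j :\: row_set i)|.
Proof.
case=> [[Reg_region _ _] _ sepE].
have N_eq : (1 + \sum_(r < p) n = 1 + n * p)%N.
  by rewrite sum_nat_const card_ord mulnC.
have Reg_i (i : 'I_(1 + \sum_(r < p) n)) : regions (Reg i).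
  by apply: Reg_region => /=; rewrite -N_eq.
have Reg_0 : regions (Reg 0%N) by apply: Reg_region.
have row_setP (i : 'I_(1 + \sum_(r < p) n)) : sep n c rho theta (Reg 0%N) (Reg i) = row_set i.
  rewrite /row_set; case: splitP => [k ->|k ->].
    rewrite ord1 /=.
    have [A -> A0] := region_cellP Reg_0.
    by rewrite sep_cell // finset.setDv finset.setU0.
  have -> : (1 + k = ((tagnat.sig1 k).+1 - 1) * n + (tagnat.sig2 k).+1)%N.
    rewrite {1}(tagnat.rect k) subn1 add1n addnS /=; congr (_ + _).+1.
    by rewrite (big_ord_narrow (ltnW (ltn_ord _))) sum_nat_const card_ord.
  by rewrite sepE //= ltn_ord.
apply/matrixP => i j; rewrite !mxE.
by rewrite (sep_regions Reg_0 (Reg_i i) (Reg_i j)) !row_setP.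
Qed.

End Labelling.

Theorem theorem3p2 (R : realType) (n p : nat) (c : R * R) (rho theta : R)
    (hn : (3 <= n)%N) (hp : p = ((n + 1) %/ 2)%N) (hrho : 0 < rho) :
  (exists Reg : nat -> set (R * R), region_labelling n c rho theta p Reg) /\
  (forall Reg : nat -> set (R * R), region_labelling n c rho theta p Reg ->
     smith_normal_form_with
       (varchenko n c rho theta (1 + \sum_(r < p) n)%N Reg)
       (snf_mx n p)
       (S_mx n p *m P_mx n p)
       ((S_mx n p *m P_mx n p)^T)).
Proof.
case: n hn hp => // m hn hp.
(* A labelling exists, so the second claim is not vacuous. *)
split; first by exists (region_of m c rho theta); apply: region_of_labelling.
move=> Reg RegL; have pn : (p <= m.+1)%N by lia.
have p2 : (p.*2 <= m.+2)%N by lia.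
split.
- by apply/is_diag_mxP => i j ij; rewrite snf_mxE // -val_eqE (negPf ij).
- by move=> i j; apply: snf_mx_dvd.
- exact: SP_mx_unit.
- by rewrite unitmx_tr; apply: SP_mx_unit.
by rewrite (varchenko_labelling RegL); apply: SP_gram.
Qed.
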